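(* Let $\mathcal B$ be a semitopological barycentric algebra, let $\mathrm{cone}(\mathcal B)$ be the associated cone equipped with its cone topology, and let $\eta_{\mathcal B}\colon \mathcal B\to \mathrm{cone}(\mathcal B)$ be the map $x\mapsto (1,x)$. Then: 1. $\mathrm{cone}(\mathcal B)$, with its cone topology, is a semitopological cone. 2. The map $\eta_{\mathcal B}$ is injective, affine and continuous. 3. For every semi-concave (resp. concave, affine) continuous map $f\colon\mathcal B\to\mathfrak C$ to a semitopological cone $\mathfrak C$, there is a unique positively homogeneous (resp. superlinear, linear) continuous map $\hat f\colon \mathrm{cone}(\mathcal B)\to\mathfrak C$ such that $\hat f\circ\eta_{\mathcal B}=f$. In particular, $\mathrm{cone}(\mathcal B)$ with the cone topology is the free semitopological cone over the semitopological barycentric algebra $\mathcal B$. 4. The following are equivalent: (a) $\mathcal B$ is embeddable, that is, there is an affine topological embedding of $\mathcal B$ in some semitopological cone; (b) $\eta_{\mathcal B}\colon\mathcal B\to\mathrm{cone}(\mathcal B)$ is a topological embedding; (c) the open subsets of $\mathcal B$ are exactly the sets $h^{-1}(]1,\infty])$ where $h$ ranges over the semi-concave lower semicontinuous maps from $\mathcal B$ to $\overline{\mathbb R}_+$; (d) the sets $h^{-1}(]1,\infty])$, where $h$ ranges over the semi-concave lower semicontinuous maps from $\mathcal B$ to $\overline{\mathbb R}_+$, form a subbase of the topology of $\mathcal B$.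
   Context: $\mathbb R_+=[0,\infty[$ and $\overline{\mathbb R}_+=\mathbb R_+\cup\{\infty\}$ (with $0\cdot\infty=0$) carry the Scott topology of the usual order: the open sets are the sets $\{t: t>a\}$ with $a\in\mathbb R_+$, the whole set and $\emptyset$. Lower semicontinuous means continuous into $\overline{\mathbb R}_+$ with this topology. The specialization preordering of a space is: $x\le y$ iff every open neighborhood of $x$ contains $y$. A topological embedding is a homeomorphism onto its image with the subspace topology. A cone is a commutative monoid $(\mathfrak C,+,0)$ with an action $(a,x)\mapsto a\cdot x$ of $\mathbb R_+$ satisfying $0\cdot x=0$, $(ab)\cdot x=a\cdot(b\cdot x)$, $1\cdot x=x$, $a\cdot 0=0$, $a\cdot(x+y)=a\cdot x+a\cdot y$, $(a+b)\cdot x=a\cdot x+b\cdot x$. A semitopological cone is a cone with a topology making $+$ and $\cdot$ separately continuous ($\mathbb R_+$ with the Scott topology); it is preordered by its specialization preordering. A barycentric algebra is a set $\mathcal B$ with binary operations $+_a$, $a\in[0,1]$, such that $x+_1y=x$, $x+_ax=x$, $x+_ay=y+_{1-a}x$, and $(x+_ay)+_bz=x+_{ab}(y+_{\frac{(1-a)b}{1-ab}}z)$ if $a<1$, $b<1$. Every cone is a barycentric algebra with $x+_ay=a\cdot x+(1-a)\cdot y$. It is semitopological if it has a topology making $(x,a,y)\mapsto x+_ay$ separately continuous on $\mathcal B\times[0,1]\times\mathcal B$, with $[0,1]$ given its usual metric topology; it is then preordered by its specialization preordering. For a map $f$ from a barycentric algebra to a preordered cone: $f$ is affine if $f(x+_ay)=f(x)+_af(y)$,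 concave if $f(x+_ay)\ge f(x)+_af(y)$, semi-concave if $f(x+_ay)\ge a\cdot f(x)$, for all $x,y$ and all $a\in[0,1]$. A map $g$ between preordered cones is positively homogeneous if $g(a\cdot u)=a\cdot g(u)$ for all $a\in\mathbb R_+$; superlinear if moreover $g(u+v)\ge g(u)+g(v)$; linear if positively homogeneous and additive. $\mathrm{cone}(\mathcal B)$ is the set of pairs $(r,x)$ with $r\in\mathbb R_+\setminus\{0\}$, $x\in\mathcal B$, plus a distinguished element $0$, with $a\cdot(r,x)=(ar,x)$ for $a>0$, $0\cdot(r,x)=0$, $a\cdot 0=0$, $(r,x)+(s,y)=(r+s,x+_{\frac{r}{r+s}}y)$, and $0$ neutral for $+$. The relation $\le^{\mathrm{cone}}$ on $\mathrm{cone}(\mathcal B)$ is: $u\le^{\mathrm{cone}}v$ iff either $u=v=0$, or $v=(s,y)$ for some $s,y$ and there are $u'\in\mathrm{cone}(\mathcal B)$ and $y_1\in\mathcal B$ with $u+u'=(s,y_1)$ and $y_1\le y$ (specialization preordering of $\mathcal B$). The cone topology on $\mathrm{cone}(\mathcal B)$ has as subbase the open subsets of $(\mathbb R_+\setminus\{0\})\times\mathcal B$ (product topology, with the Scott topology on $\mathbb R_+\setminus\{0\}$) that are upwards-closed in $\mathrm{cone}(\mathcal B)$ with respect to $\le^{\mathrm{cone}}$. Free means: for every semitopological cone $\mathfrak C$, every affine continuous map $\mathcal B\to\mathfrak C$ factors uniquely through $\eta_{\mathcal B}$ via a linear continuous map. *)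

(* Defs.v *)
From HB Require Import structures.
From mathcomp Require Import all_boot all_order all_algebra.
From mathcomp Require Import ring lra.
From mathcomp Require Import all_classical all_reals.
From mathcomp Require Import interval_inference topology convex.

Set Implicit Arguments.
Unset Strict Implicit.
Unset Printing Implicit Defensive.

Import Order.TTheory GRing.Theory Num.Theory.
Import numFieldTopology.Exports.

Local Open Scope classical_set_scope.
Local Open Scope ring_scope.
Local Open Scope convex_scope.

(* The specialization preordering. *)
Definition specle {T : topologicalType} (x y : T) : Prop :=
  forall U : set T, open U -> U x -> U y.

Definition topological_embedding {S T : topologicalType} (f : S -> T) : Prop :=
  [/\ injective f, continuous f &
      forall U : set S, open U ->
        exists2 V : set T, open V & f @` U = V `&` range f].

(* As in the factory isSubBaseTopological: the open sets are the unions of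
   finite intersections (the empty one included) of members of F. *)
Definition is_subbase {T : topologicalType} (F : set (set T)) : Prop :=
  forall U : set T,
    open U <-> exists2 D, D `<=` finI_from F id & \bigcup_(A in D) A = U.

(* R_+ as a semiring, so that a cone is an lSemiModType over it: the law
   a *: 0 = 0 is scaler0. *)
Record nnreal (R : realType) := NNReal {
  nnval :> R;
  nnvalP : nnval \in Num.nneg
}.

HB.instance Definition _ (R : realType) := [isSub for @nnval R].
HB.instance Definition _ (R : realType) := [Choice of nnreal R by <:].
HB.instance Definition _ (R : realType) :=
  [SubChoice_isSubComNzSemiRing of nnreal R by <:].

Definition posreal (R : realType) := {posnum R}.

HB.instance Definition _ (R : realType) :=
  Choice.copy (posreal R) {posnum R}.

Record ennreal (R : realType) := ENNReal {
  ennval :> \bar R;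
  ennvalP : (0 <= ennval)%E
}.

HB.instance Definition _ (R : realType) := [isSub for @ennval R].
HB.instance Definition _ (R : realType) := [Choice of ennreal R by <:].

(* The Scott topology on R_+, R_+ \ {0} and [0, +oo], seen inside \bar R
   through v. On R_+ \ {0} it is the subspace topology of R_+. *)
Definition scott_open (R : realType) (T : Type) (v : T -> \bar R)
    (U : set T) : Prop :=
  [\/ U = set0, U = setT |
      exists a : nnreal R, U = [set t | ((a : R)%:E < v t)%E]].

Section scott_topology.
Context (R : realType) (T : Type) (v : T -> \bar R).

Lemma scott_openT : scott_open v setT.
Proof. by apply: Or32. Qed.

Lemma scott_openI : setI_closed (scott_open v).
Proof.
move=> U V [->|->|[a ->]].
- by move=> _; rewrite set0I; apply: Or31.
- by rewrite setTI.
move=> [->|->|[b ->]].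
- by rewrite setI0; apply: Or31.
- by rewrite setIT; apply: Or33; exists a.
apply: Or33; have [ab|/ltW ba] := leP (a : R) (b : R).
  exists b; apply/seteqP; split=> t /= => [[]//|bt]; split=> //.
  by apply: le_lt_trans bt; rewrite lee_fin.
exists a; apply/seteqP; split=> t /= => [[]//|at_]; split=> //.
by apply: le_lt_trans at_; rewrite lee_fin.
Qed.

Lemma scott_open_bigU (I : Type) (f : I -> set T) :
  (forall i, scott_open v (f i)) -> scott_open v (\bigcup_i f i).
Proof.
move=> fo.
have [[i fi]|nT] := pselect (exists i, f i = setT).
  by apply: Or32; apply/seteqP; split=> // t _; exists i => //; rewrite fi.
pose E := [set x : R | exists2 i, exists t, f i t &
  exists2 a : nnreal R, (a : R) = x & f i = [set t | ((a : R)%:E < v t)%E]].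
have [E0|/set0P E0] := eqVneq E set0.
  apply: Or31; apply/seteqP; split=> // t [i _ fit].
  have [fi|fi|[a fi]] := fo i; first by move: fit; rewrite fi.
    by apply: nT; exists i.
  have : E (a : R) by exists i; [exists t|exists a].
  by rewrite E0.
have lE : lbound E 0 by move=> x [i _ [a <- _]]; have := nnvalP a.
have E_inf : has_inf E by split=> //; exists 0.
have infE : inf E \in Num.nneg by rewrite nnegrE; apply: lb_le_inf.
apply: Or33; exists (NNReal infE); apply/seteqP; split=> t /=.
  move=> [i _ fit].
  have [fi|fi|[a fi]] := fo i; first by move: fit; rewrite fi.
    by exfalso; apply: nT; exists i.
  have := fit; rewrite fi /=; apply: le_lt_trans.
  by rewrite lee_fin; apply: (inf_lbound (proj2 E_inf)); exists i;
    [exists t|exists a].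
move=> inft.
suff [x [i _ [a <- fi]] xt] : exists2 x, E x & (x%:E < v t)%E.
  by exists i => //; rewrite fi.
move: inft; case: (v t) => [r| |] //=.
  rewrite lte_fin => /(inf_lt (proj1 E_inf)) [x Ex xr]; exists x => //.
by move=> _; case: E0 => x Ex; exists x => //; rewrite ltry.
Qed.

End scott_topology.

HB.instance Definition _ (R : realType) :=
  let v (t : nnreal R) := (t : R)%:E in
  isOpenTopological.Build (nnreal R)
    (scott_openT v) (@scott_openI R _ v) (@scott_open_bigU R _ v).

HB.instance Definition _ (R : realType) :=
  let v (t : posreal R) := (t%:num)%:E in
  isOpenTopological.Build (posreal R)
    (scott_openT v) (@scott_openI R _ v) (@scott_open_bigU R _ v).

HB.instance Definition _ (R : realType) :=
  isOpenTopological.Build (ennreal R)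
    (scott_openT (@ennval R)) (@scott_openI R _ (@ennval R))
    (@scott_open_bigU R _ (@ennval R)).

(* [0, 1] with its usual metric topology. *)
Definition unit_interval (R : realType) : Type :=
  initial_topology (fun a : {i01 R} => (a%:num : R)).
HB.instance Definition _ (R : realType) :=
  Topological.copy (unit_interval R)
    (initial_topology (fun a : {i01 R} => (a%:num : R))).

Lemma nn01_subproof (R : realType) (a : {i01 R}) : a%:num \in Num.nneg.
Proof. by rewrite nnegrE. Qed.

Definition nn01 (R : realType) (a : {i01 R}) : nnreal R :=
  NNReal (nn01_subproof a).

(* Barycentric algebras are the convTypes of the library: x <| a |> y is
   x +_a y, and convA is the associativity law in which the weights are only
   required to satisfy p = r s and 1 - s = (1 - p)(1 - q). *)
#[short(type="topConvType")]
HB.structure Definition TopConv (R : realType) :=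
  {B of ConvexSpace R B & Topological B}.

Definition semitopological_barycentric (R : realType) (B : topConvType R) :
    Prop :=
  [/\ forall (a : {i01 R}) (y : B), continuous (fun x : B => x <| a |> y),
      forall x y : B, continuous (fun a : unit_interval R => x <| a |> y : B) &
      forall (x : B) (a : {i01 R}), continuous (fun y : B => x <| a |> y)].

(* A cone with a topology, with no compatibility requirement. *)
#[short(type="topConeType")]
HB.structure Definition TopCone (R : realType) :=
  {C of GRing.LSemiModule (nnreal R) C & Topological C}.

Definition semitopological_cone (R : realType) (C : topConeType R) : Prop :=
  [/\ forall v : C, continuous (fun u : C => u + v),
      forall u : C, continuous (fun v : C => u + v),
      forall a : nnreal R, continuous (fun u : C => a *: u) &
      forall u : C, continuous (fun a : nnreal R => a *: u : C)].

Section maps.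
Context (R : realType).

Definition cone_conv (C : topConeType R) (a : {i01 R}) (u v : C) : C :=
  nn01 a *: u + nn01 (1 - a%:num)%:i01 *: v.

Definition affine (B : topConvType R) (C : topConeType R) (f : B -> C) : Prop :=
  forall (a : {i01 R}) (x y : B), f (x <| a |> y) = cone_conv a (f x) (f y).

(* The target is preordered by its specialization preordering, which on
   ennreal is the usual order: see ennreal_specle below. *)
Definition concave (B : topConvType R) (C : topConeType R) (f : B -> C) :
    Prop :=
  forall (a : {i01 R}) (x y : B),
    specle (cone_conv a (f x) (f y)) (f (x <| a |> y)).

Definition semi_concave (B : topConvType R) (C : topConeType R) (f : B -> C) :
    Prop :=
  forall (a : {i01 R}) (x y : B), specle (nn01 a *: f x) (f (x <| a |> y)).

Definition positively_homogeneous (C D : topConeType R) (g : C -> D) : Prop :=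
  forall (a : nnreal R) (u : C), g (a *: u) = a *: g u.

Definition superlinear (C D : topConeType R) (g : C -> D) : Prop :=
  positively_homogeneous g /\ forall u v : C, specle (g u + g v) (g (u + v)).

Definition linear_map (C D : topConeType R) (g : C -> D) : Prop :=
  positively_homogeneous g /\ {morph g : u v / u + v}.

Definition embeddable (B : topConvType R) : Prop :=
  exists (C : topConeType R) (f : B -> C),
    [/\ semitopological_cone C, affine f & topological_embedding f].

Definition free_semitopological_cone (B : topConvType R) (K : topConeType R)
    (eta : B -> K) : Prop :=
  [/\ semitopological_cone K, affine eta, continuous eta &
      forall (C : topConeType R) (f : B -> C),
        semitopological_cone C -> affine f -> continuous f ->
        exists! g : K -> C, [/\ linear_map g, continuous g & g \o eta = f]].

End maps.

(* [0, +oo] as a cone; the product on \bar R satisfies 0 * +oo = 0. *)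
Section ennreal_cone.
Context (R : realType).
Implicit Types (x y : ennreal R) (a b : nnreal R).
Local Open Scope ereal_scope.

Definition enn0 : ennreal R := ENNReal (lexx 0).
Definition enn_add x y : ennreal R := ENNReal (adde_ge0 (ennvalP x) (ennvalP y)).

Lemma nnreal_ge0 a : 0 <= (a : R)%:E.
Proof. by rewrite lee_fin; have := nnvalP a. Qed.

Definition enn_scale a x : ennreal R :=
  ENNReal (mule_ge0 (nnreal_ge0 a) (ennvalP x)).

Lemma enn_addA : associative enn_add.
Proof. by move=> x y z; apply/val_inj => /=; rewrite addeA. Qed.
Lemma enn_addC : commutative enn_add.
Proof. by move=> x y; apply/val_inj => /=; rewrite addeC. Qed.
Lemma enn_add0 : left_id enn0 enn_add.
Proof. by move=> x; apply/val_inj => /=; rewrite add0e. Qed.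

HB.instance Definition _ :=
  GRing.isNmodule.Build (ennreal R) enn_addA enn_addC enn_add0.

Lemma enn_scaleA a b x : enn_scale a (enn_scale b x) = enn_scale (a * b)%R x.
Proof. by apply/val_inj => /=; rewrite muleA EFinM. Qed.
Lemma enn_scale0 x : enn_scale 0%R x = 0%R.
Proof. by apply/val_inj => /=; rewrite mul0e. Qed.
Lemma enn_scale1 : left_id 1%R enn_scale.
Proof. by move=> x; apply/val_inj => /=; rewrite mul1e. Qed.
Lemma enn_scaleDr : right_distributive enn_scale +%R.
Proof.
by move=> a x y; apply/val_inj => /=; rewrite ge0_muleDr// ennvalP.
Qed.
Lemma enn_scaleDl x : {morph enn_scale^~ x : a b / (a + b)%R}.
Proof.
by move=> a b; apply/val_inj => /=; rewrite EFinD ge0_muleDl// nnreal_ge0.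
Qed.

HB.instance Definition _ :=
  GRing.Nmodule_isLSemiModule.Build (nnreal R) (ennreal R)
    enn_scaleA enn_scale0 enn_scale1 enn_scaleDr enn_scaleDl.

Lemma ennreal_specle x y : specle x y <-> ennval x <= ennval y.
Proof.
split=> [xy|xy U]; last first.
  by move=> [->|->|[a ->]] //= ax; apply: (lt_le_trans ax).
rewrite leNgt; apply/negP => yx.
have yfin : ennval y \is a fin_num.
  by rewrite ge0_fin_numE ?ennvalP// (lt_le_trans yx)// leey.
have y0 : fine (ennval y) \in Num.nneg by rewrite nnegrE fine_ge0// ennvalP.
have := xy [set t | (fine (ennval y))%:E < ennval t]; rewrite fineK//=.
have Uo : open [set t : ennreal R | ennval y < ennval t].
  by apply: Or33; exists (NNReal y0); rewrite /= fineK.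
by move=> /(_ Uo yx); rewrite ltxx.
Qed.

End ennreal_cone.

(* None is the distinguished element 0 and Some (r, x) is the pair (r, x). *)
Definition cone_of (R : realType) (B : convType R) : Type :=
  option (posreal R * B).

HB.instance Definition _ (R : realType) (B : convType R) :=
  Choice.copy (cone_of B) (option (posreal R * B)).

Section cone_of.
Context (R : realType) (B : convType R).
Implicit Types (r s t : {posnum R}) (u v w : cone_of B) (a b : nnreal R).

Lemma weight_ge0 r s : 0 <= r%:num / (r%:num + s%:num).
Proof. by []. Qed.

Lemma weight_le1 r s : r%:num / (r%:num + s%:num) <= 1.
Proof. by rewrite ler_pdivrMr// mul1r lerDl. Qed.

Definition weight r s : {i01 R} := Itv01 (weight_ge0 r s) (weight_le1 r s).

Definition cone_add u v : cone_of B :=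
  match u, v with
  | None, _ => v
  | _, None => u
  | Some (r, x), Some (s, y) =>
      Some ((r%:num + s%:num)%:pos, x <| weight r s |> y)
  end.

Definition cone_scale a u : cone_of B :=
  match u, pselect (0 < (a : R)) with
  | Some (r, x), left a0 => Some (((PosNum a0)%:num * r%:num)%:pos, x)
  | _, _ => None
  end.

Lemma cone_addA : associative cone_add.
Proof.
move=> [[r x]|] [[s y]|] [[t z]|] //=; congr (Some (_, _)).
  by apply/val_inj => /=; rewrite addrA.
by apply: convA => /=; rewrite /unstable.onem; field; rewrite !gt_eqF.
Qed.

Lemma cone_addC : commutative cone_add.
Proof.
move=> [[r x]|] [[s y]|] //=; congr (Some (_, _)).
  by apply/val_inj => /=; rewrite addrC.
rewrite convC; congr (_ <| _ |> _); apply/val_inj => /=.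
by field; rewrite !gt_eqF.
Qed.

Lemma cone_add0 : left_id None cone_add.
Proof. by []. Qed.

HB.instance Definition _ :=
  GRing.isNmodule.Build (cone_of B) cone_addA cone_addC cone_add0.

Lemma cone_scaleA a b u : cone_scale a (cone_scale b u) = cone_scale (a * b) u.
Proof.
case: u => [[r x]|] //=.
have a_ge0 : 0 <= (a : R) := nnvalP a.
have b_ge0 : 0 <= (b : R) := nnvalP b.
case: (pselect (0 < (b : R))) => b0 /=; last first.
  case: pselect => //= ab0; exfalso; apply: b0; rewrite lt_neqAle b_ge0 andbT.
  by apply/eqP => b0; move: ab0; rewrite /= -b0 mulr0 ltxx.
case: (pselect (0 < (a : R))) => a0 /=; case: pselect => //= ab0.
- by congr (Some (_, _)); apply/val_inj => /=; rewrite mulrA.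
- by exfalso; apply: ab0; rewrite mulr_gt0.
- by exfalso; apply: a0; move: ab0; rewrite pmulr_lgt0.
Qed.

Lemma cone_scale0 u : cone_scale 0 u = 0.
Proof.
case: u => [[r x]|] //=; case: pselect => //= h.
by have := ltxx (0 : R); rewrite h.
Qed.

Lemma cone_scale1 : left_id 1 cone_scale.
Proof.
move=> [[r x]|] //=; case: pselect => /= [h|]; last by rewrite ltr01.
by congr (Some (_, _)); apply/val_inj => /=; rewrite mul1r.
Qed.

Lemma cone_scaleDr : right_distributive cone_scale +%R.
Proof.
move=> a [[r x]|] [[s y]|] //=; rewrite /cone_scale; case: pselect => //= a0.
congr (Some (_, _)); first by apply/val_inj => /=; rewrite mulrDr.
congr (_ <| _ |> _); apply/val_inj => /=; field.
by rewrite -mulrDr mulf_neq0 ?(gt_eqF a0)// gt_eqF.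
Qed.

Lemma cone_scaleDl u : {morph cone_scale^~ u : a b / a + b}.
Proof.
move=> a b; case: u => [[r x]|] //=; rewrite /cone_scale.
have a_ge0 : 0 <= (a : R) := nnvalP a.
have b_ge0 : 0 <= (b : R) := nnvalP b.
case: (pselect (0 < (a : R))) => a0; case: (pselect (0 < (b : R))) => b0;
  case: pselect => //= ab0.
- congr (Some (_, _)); last by rewrite convmm.
  by apply/val_inj => /=; rewrite mulrDl.
- by exfalso; apply: ab0; rewrite addr_gt0.
- congr (Some (_, _)); apply/val_inj => /=.
  by rewrite (_ : (b : R) = 0) ?addr0//; lra.
- by exfalso; apply: ab0; rewrite ltr_wpDr.
- congr (Some (_, _)); apply/val_inj => /=.
  by rewrite (_ : (a : R) = 0) ?add0r//; lra.
- by exfalso; apply: ab0; rewrite ltr_wpDl.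
- by exfalso; move: ab0; rewrite /=; lra.
Qed.

HB.instance Definition _ :=
  GRing.Nmodule_isLSemiModule.Build (nnreal R) (cone_of B)
    cone_scaleA cone_scale0 cone_scale1 cone_scaleDr cone_scaleDl.

End cone_of.

Section cone_topology.
Context (R : realType) (B : topConvType R).

Definition cone_le (u v : cone_of B) : Prop :=
  (u = 0 /\ v = 0) \/
  exists s y, v = Some (s, y) /\
    exists (u' : cone_of B) (y1 : B), u + u' = Some (s, y1) /\ specle y1 y.

Definition cone_subbase : set (set (cone_of B)) :=
  [set U | (forall u v, cone_le u v -> U u -> U v) /\
    exists2 W : set (posreal R * B), open W & U = Some @` W].

HB.instance Definition _ :=
  isSubBaseTopological.Build (cone_of B) cone_subbase id.

Definition eta (x : B) : cone_of B := Some (1%:pos, x).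

End cone_topology.

(* Main.v *)
Require Import Defs.
From mathcomp Require Import all_boot all_order all_algebra.
From mathcomp Require Import ring lra.
From mathcomp Require Import all_classical all_reals.
From mathcomp Require Import interval_inference topology ereal normedtype
  convex.

Set Implicit Arguments.
Unset Strict Implicit.
Unset Printing Implicit Defensive.

Import Order.TTheory GRing.Theory Num.Theory.
Import numFieldTopology.Exports numFieldNormedType.Exports.

Local Open Scope classical_set_scope.
Local Open Scope ring_scope.
Local Open Scope convex_scope.

(** Everything about the cone topology is reduced to a description of its open
sets that never mentions joint openness in (R_+ \ {0}) x B (open_coneP): a
set U of the cone is open iff it is closed under adding arbitrary elements,
each section {x | (r, x) \in U} is open in B, and (r, x) \in U forces
(q, x) \in U for some q < r. Indeed, a product set that is upwards closed in
its Scott coordinate is open as soon as it is separately open: from a point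
(r, x), first lower r to some q < r inside the set, then move x at level q in
an open set of B, and let upward closure supply all the levels above q. The
specialization part of the cone order comes for free, since open sections
respect it.

This is why a separately continuous B gives a separately continuous cone.
Adding (s, y) to (r, x) moves both the total weight r + s and the barycenter
x +_{r/(r+s)} y, but the criterion only asks to move x at fixed weights, or to
lower r slightly at fixed x; the latter is continuity of the barycenter in its
coefficient combined with the left approximation of the weight
(cone_add_continuous).

A map f on B extends in only one positively homogeneous way, by
(r, x) |-> r f(x) and 0 |-> 0 (cone_lift_unique). In a semitopological cone 0 is
below every element, because a |-> a v is continuous for the Scott topology;
hence u <= u + v, so concave implies semi-concave, and semi-concavity of f is
exactly what makes the extension monotone under addition, thus continuous by
the criterion (cone_lift_continuous).

For embeddability, the link between open sets and maps to [0, +oo] is the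
Minkowski functional u |-> sup {r > 0 | r^-1 u \in V} of an open set V of a
semitopological cone: it is lower semicontinuous, V is the set where it
exceeds 1, and composed with a semi-concave map it is semi-concave. So if eta is
an embedding every open set of B is some h^-1(]1, +oo]). Conversely each
semi-concave lower semicontinuous h extends to the cone, so h^-1(]1, +oo]) is
the preimage under eta of an open set; if these sets form a subbase, all open
sets of B are such preimages and eta is an embedding. Likewise, an affine
embedding of B in a semitopological cone factors through eta by a continuous
map, which makes eta an embedding. *)

(** * Specialization, embeddings and subbases *)

Lemma open_from_nbhs (T : topologicalType) (U : set T) :
  (forall x, U x -> exists V, [/\ open V, V x & V `<=` U]) -> open U.
Proof.
by move=> h; rewrite openE => x /h[V [oV Vx VU]]; rewrite /interior nbhsE;
  exists V.
Qed.

Lemma specle_trans (T : topologicalType) (x y z : T) :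
  specle x y -> specle y z -> specle x z.
Proof. by move=> xy yz U oU /(xy _ oU)/(yz _ oU). Qed.

Lemma specle_homo (S T : topologicalType) (f : S -> T) (x y : S) :
  continuous f -> specle x y -> specle (f x) (f y).
Proof. by move=> /continuousP cf xy U oU; apply: (xy _ (cf _ oU)). Qed.

(** The preimage form is the one that composes with extensions of maps. *)
Lemma topological_embeddingP (S T : topologicalType) (f : S -> T) :
  topological_embedding f <->
  [/\ injective f, continuous f &
      forall U, open U -> exists2 V, open V & U = f @^-1` V].
Proof.
split=> -[fI cf fo]; split=> // U /fo[V oV].
  move=> fUV; exists V => //; apply/seteqP; split=> x.
    by move=> Ux; have : (f @` U) (f x) by [exists x]; rewrite fUV => -[].
  move=> Vfx; have : (f @` U) (f x) by rewrite fUV; split=> //; exists x.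
  by case=> y Uy /fI <-.
move=> ->; exists V => //; apply/seteqP; split=> y.
  by case=> x Vx <-; split=> //; exists x.
by case=> Vy [x _ xy]; exists x; rewrite //= xy.
Qed.

(** Preimages of open sets are closed under finite intersections and unions, so
it suffices to realize the members of a subbase. *)
Lemma subbase_preimage (S T : topologicalType) (f : S -> T) (F : set (set S)) :
  is_subbase F ->
  (forall A, F A -> exists2 V, open V & A = f @^-1` V) ->
  forall U, open U -> exists2 V, open V & U = f @^-1` V.
Proof.
move=> sF FV U /sF[D DF <-].
have finV A : finI_from F id A -> exists2 V, open V & A = f @^-1` V.
  move=> [E EF <-]; rewrite bigcap_fset big_seq.
  elim/big_ind: _ => [|A1 A2 [V1 o1 ->] [V2 o2 ->]|A1 /EF /[!inE]];
    last exact: FV.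
    by exists setT; [exact: openT|rewrite preimage_setT].
  by exists (V1 `&` V2); [exact: openI|rewrite preimage_setI].
(* All suitable open sets at once, which avoids choosing one per member of D. *)
exists (\bigcup_(V in [set V | open V /\ D (f @^-1` V)]) V).
  by apply: bigcup_open => V [].
apply/seteqP; split=> x [A].
  move=> DA; have [V oV AV] := finV _ (DF _ DA); rewrite AV => Vx.
  by exists V => //=; rewrite -AV.
by move=> [_ DA] Ax; exists (f @^-1` A).
Qed.

(** * Scott topologies on the nonnegative and positive reals *)

Definition nn_of_pos (R : realType) (r : {posnum R}) : nnreal R :=
  NNReal (ge0 r : r%:num \in Num.nneg).

Lemma posreal_half (R : realType) (a : nnreal R) (r : {posnum R}) :
  (a : R) < r%:num ->
  exists2 q : {posnum R}, (a : R) < q%:num & q%:num < r%:num.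
Proof.
move=> ar; have a0 : 0 <= (a : R) := nnvalP a.
have q0 : 0 < ((a : R) + r%:num) / 2 by rewrite divr_gt0// ltr_wpDl.
by exists (PosNum q0) => /=; lra.
Qed.

(** Separate openness is enough: at (r, x), first go down to q < r, then let x
vary at level q; upward closure fills in the whole box above q. *)
Lemma open_up_prod (R : realType) (T : topologicalType)
    (W : set (posreal R * T)) :
  (forall r s x, r%:num <= s%:num -> W (r, x) -> W (s, x)) ->
  open W <-> (forall r, open [set x | W (r, x)]) /\
    forall r x, W (r, x) -> exists2 q : posreal R, q%:num < r%:num & W (q, x).
Proof.
move=> up; split=> [oW|[oW lW]].
  split=> [r|r x Wrx].
    rewrite openE => x Wrx.
    have : nbhs (r, x) W by move: oW; rewrite openE; apply.
    case=> -[A1 A2] /= [nA1 nA2] AW.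
    apply: filterS nA2 => y A2y; apply: (AW (r, y)); split=> //=.
    exact: nbhs_singleton.
  have : nbhs (r, x) W by move: oW; rewrite openE; apply.
  case=> -[A1 A2] /= [nA1 nA2] AW.
  have A2x := nbhs_singleton nA2.
  move: nA1; rewrite nbhsE => -[A [oA Ar] AA1].
  suff [q qr Aq] : exists2 q : posreal R, q%:num < r%:num & A q.
    by exists q => //; apply: (AW (q, x)); split=> //=; exact: AA1.
  case: oA Ar => [->//|->|[a ->]] /=.
    move=> _; have [q _ qr] := @posreal_half R 0 r (gt0 r).
    by exists q.
  rewrite lte_fin => /posreal_half[q aq qr].
  by exists q => //=; rewrite lte_fin.
rewrite openE => -[r x] /lW[q qr Wqx].
exists ([set t : posreal R | q%:num < t%:num], [set y | W (q, y)]) => /=.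
  split; apply: open_nbhs_nbhs; split=> //=.
  by apply: Or33; exists (nn_of_pos q).
by move=> [t y] /= [qt Wqy]; apply: up Wqy; exact: ltW.
Qed.

(** * The order of a semitopological cone *)

(** A Scott open set of R_+ that contains 0 is everything, so that
0 = 0 *: v lies below 1 *: v. *)
Lemma cone_ge0 (R : realType) (C : topConeType R) (hC : semitopological_cone C)
  (v : C) : specle 0 v.
Proof.
move=> U oU U0; have [_ _ _ /(_ v)/continuousP/(_ _ oU)] := hC.
have i0 : ((fun a : nnreal R => a *: v) @^-1` U) 0 by rewrite /= scale0r.
case=> [h|h|[a h]]; move: i0; rewrite h //=.
  by move=> _; rewrite -[v]scale1r; have : [set: nnreal R] 1 by []; rewrite -h.
by rewrite lte_fin ltNge; have /= := nnvalP a; rewrite nnegrE => ->.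
Qed.

Lemma specle_addr (R : realType) (C : topConeType R)
  (hC : semitopological_cone C) (u v : C) : specle u (u + v).
Proof.
have [_ /(_ u) cu _ _] := hC.
by have := specle_homo cu (cone_ge0 hC v); rewrite addr0.
Qed.

Lemma open_nnreal_lt (R : realType) (W : set (nnreal R)) (r : {posnum R}) :
  open W -> W (nn_of_pos r) ->
  exists2 q : {posnum R}, q%:num < r%:num & W (nn_of_pos q).
Proof.
case=> [->//|->|[a ->]] /=.
  by move=> _; have [q _ qr] := @posreal_half R 0 r (gt0 r); exists q.
rewrite lte_fin => /posreal_half[q aq qr].
by exists q => //=; rewrite lte_fin.
Qed.

(** The scalars that send v into V form a Scott open set, and such a set has no
least positive element. *)
Lemma open_scale_lt (R : realType) (C : topConeType R)
    (hC : semitopological_cone C) (V : set C) (r : {posnum R}) (v : C) :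
  open V -> V (nn_of_pos r *: v) ->
  exists2 q : {posnum R}, q%:num < r%:num & V (nn_of_pos q *: v).
Proof.
move=> oV; have [_ _ _ /(_ v)/continuousP/(_ _ oV)] := hC.
exact: open_nnreal_lt.
Qed.

(** * The open sets of the cone topology *)

Lemma Some_scale (R : realType) (B : topConvType R) (r : {posnum R}) (x : B) :
  Some (r, x) = nn_of_pos r *: eta x.
Proof.
rewrite /eta /GRing.scale/= /cone_scale; case: pselect => [/= r0|/=];
  last by rewrite gt0.
by congr (Some (_, _)); apply/val_inj; rewrite /= mulr1.
Qed.

Lemma scale_Some (R : realType) (B : topConvType R) (a r : {posnum R}) (x : B) :
  nn_of_pos a *: (Some (r, x) : cone_of B) = Some ((a%:num * r%:num)%:pos, x).
Proof.
rewrite /GRing.scale/= /cone_scale; case: pselect => [/= r0|/=];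
  last by rewrite gt0.
by congr (Some (_, _)); apply/val_inj.
Qed.

Lemma nnreal_posP (R : realType) (a : nnreal R) :
  a = 0 \/ exists r, a = nn_of_pos r.
Proof.
have a0 : 0 <= (a : R) := nnvalP a.
move: a0; rewrite le_eqVlt => /predU1P[a0|a0]; [left|right].
  by apply/val_inj => /=.
by exists (PosNum a0); apply/val_inj.
Qed.

Lemma add_Some (R : realType) (B : topConvType R) (r s : {posnum R}) (x y : B) :
  (Some (r, x) : cone_of B) + Some (s, y) =
  Some ((r%:num + s%:num)%:pos, x <| weight r s |> y).
Proof. by []. Qed.

Lemma Some_split (R : realType) (B : topConvType R) (r s : {posnum R}) (x : B) :
  r%:num < s%:num ->
  exists v : cone_of B, Some (s, x) = (Some (r, x) : cone_of B) + v.
Proof.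
rewrite -subr_gt0 => rs; exists (Some (PosNum rs, x)).
rewrite add_Some convmm; congr (Some (_, _)); apply/val_inj => /=.
by rewrite addrC subrK.
Qed.

(** These conditions turn out to characterize the open sets (open_coneP). *)
Definition cone_open (R : realType) (B : topConvType R) (U : set (cone_of B)) :=
  [/\ forall u v, U u -> U (u + v),
      forall r, open [set x | U (Some (r, x))] &
      forall (r : {posnum R}) x, U (Some (r, x)) ->
        exists2 q : {posnum R}, q%:num < r%:num & U (Some (q, x))].

Lemma cone_open_ler (R : realType) (B : topConvType R) (U : set (cone_of B))
  (r s : {posnum R}) (x : B) : (forall u v, U u -> U (u + v)) ->
  r%:num <= s%:num -> U (Some (r, x)) -> U (Some (s, x)).
Proof.
move=> Uup; rewrite le_eqVlt => /predU1P[rs|rs]; last first.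
  by have [v ->] := Some_split x rs; exact: Uup.
by have -> : r = s by apply/val_inj.
Qed.

Lemma cone_openI (R : realType) (B : topConvType R) (U V : set (cone_of B)) :
  cone_open U -> cone_open V -> cone_open (U `&` V).
Proof.
move=> [U1 U2 U3] [V1 V2 V3];
  split=> [u v [Uu Vu]|r|r x [/U3[q qr Uq] /V3[p pr Vp]]].
- by split; [exact: U1|exact: V1].
- exact: openI (U2 r) (V2 r).
have [qp|/ltW pq] := leP q%:num p%:num.
  by exists p => //; split=> //; exact: cone_open_ler Uq.
by exists q => //; split=> //; exact: cone_open_ler Vp.
Qed.

Lemma cone_openT (R : realType) (B : topConvType R) :
  cone_open [set: cone_of B].
Proof.
split=> // [r|r x _]; first exact: openT.
by have [q _ qr] := @posreal_half R 0 r (gt0 r); exists q.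
Qed.

Lemma cone_open_bigcup (R : realType) (B : topConvType R) (I : Type) (D : set I)
    (F : I -> set (cone_of B)) :
  (forall i, D i -> cone_open (F i)) -> cone_open (\bigcup_(i in D) F i).
Proof.
move=> Fo; split=> [u v [i Di Fu]|r|r x [i Di Fx]].
- by exists i => //; have [+ _ _] := Fo _ Di; apply.
- rewrite [X in open X](_ : _ = \bigcup_(i in D) [set x | F i (Some (r, x))])//.
  by apply: bigcup_open => i /Fo[].
- by have [_ _ /(_ _ _ Fx)[q qr Fq]] := Fo _ Di; exists q => //; exists i.
Qed.

Lemma cone_le_addr (R : realType) (B : topConvType R) (u v : cone_of B) :
  cone_le u (u + v).
Proof.
case E : (u + v) => [[s y]|]; first by right; exists s, y; split=> //;
  exists v, y; split=> // U.
by left; split=> //; case: u v E => [[r x]|] [[s y]|].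
Qed.

Lemma cone_le_specle (R : realType) (B : topConvType R) r (x y : B) :
  specle x y -> cone_le (Some (r, x)) (Some (r, y)).
Proof.
by move=> xy; right; exists r, y; split=> //; exists 0, x; rewrite addr0.
Qed.

(** The cone order is generated by u <= u + v and by the specialization
preordering at a fixed weight. *)
Lemma cone_leP (R : realType) (B : topConvType R) (U : set (cone_of B)) :
  (forall u v, cone_le u v -> U u -> U v) <->
  (forall u v, U u -> U (u + v)) /\
  (forall r x y, specle x y -> U (Some (r, x)) -> U (Some (r, y))).
Proof.
split=> [Uup|[Uup Ule] u v].
  split=> [u v|r x y xy]; first exact/Uup/cone_le_addr.
  exact/Uup/cone_le_specle.
case=> [[-> ->]//|[s [y [-> [u' [y1 [uE y1y]]]]]] Uu].
by apply: Ule y1y _; rewrite -uE; exact: Uup.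
Qed.

Lemma cone_subbase_open (R : realType) (B : topConvType R)
    (U : set (cone_of B)) : cone_subbase U -> cone_open U.
Proof.
case=> /cone_leP[Uup _] [W oW UE].
have UW r x : U (Some (r, x)) = W (r, x).
  rewrite UE; apply/propext; split=> [|Wrx]; last by exists (r, x).
  by case=> -[s y] Wsy [<- <-].
case/open_up_prod: oW => [r s x rs|oW lW].
  by rewrite -!UW; exact: cone_open_ler.
split=> // [r|r x]; first by under eq_set do rewrite UW.
by rewrite UW => /lW[q qr]; exists q; rewrite // UW.
Qed.

(** The condition on sections already implies closure under the specialization
part of the cone order. A subbasic set never contains 0, but cone_open only
lets 0 belong to the whole cone, which is open anyway. *)
Lemma open_coneP (R : realType) (B : topConvType R) (U : set (cone_of B)) :
  open U <-> cone_open U.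
Proof.
split=> [[D DF <-]|oU].
  apply: cone_open_bigcup => _ /DF[E EF <-]; rewrite bigcap_fset big_seq.
  elim/big_ind: _ => [||A /EF /[!inE]]; last exact: cone_subbase_open.
  - exact: cone_openT.
  - exact: cone_openI.
have [Uup oS lU] := oU.
have [U0|nU0] := pselect (U 0).
  have -> : U = setT by apply/seteqP; split=> // u _; rewrite -[u]add0r;
    exact: Uup.
  exact: openT.
suff US : cone_subbase U.
  exists [set U]; last by rewrite bigcup_set1.
  by move=> _ ->; apply: (@finI_from1 _ _ _ id).
split.
  apply/cone_leP; split=> // r x y xy; exact: (xy [set x | U (Some (r, x))]).
exists [set p | U (Some p)]; last first.
  by apply/seteqP; split=> [[p|] Up|_ [p Up <-]]//; exists p.
by apply/open_up_prod => // r s x rs; exact: cone_open_ler.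
Qed.

(** * The cone is semitopological and eta is continuous and affine *)

(** The coefficient r / (r + s) is continuous in r for the metric topology, so
r can be lowered with the coefficient staying in N and r above a bound m. *)
Lemma open_weight_lt (R : realType) (r s : {posnum R}) (m : R)
    (N : set (unit_interval R)) :
  open N -> N (weight r s) -> m < r%:num ->
  exists q : {posnum R}, [/\ m < q%:num, q%:num < r%:num & N (weight q s)].
Proof.
case=> O oO <- /= Or mr.
have : nbhs r%:num [set t : R | O (t / (t + s%:num))].
  have c : (fun t : R => t / (t + s%:num)) @ r%:num -->
      r%:num / (r%:num + s%:num).
    apply: cvgM; first exact: cvg_id.
    apply: cvgV; first by rewrite gt_eqF.
    by apply: cvgD; [exact: cvg_id|exact: cvg_cst].
  by apply: c; exact: open_nbhs_nbhs.
case/nbhs_ballP => e /= e0 eO.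
pose k := Num.min e (Num.min r%:num (r%:num - m)).
have k0 : 0 < k by rewrite !lt_min e0 subr_gt0 mr gt0.
have [ke kr km] : [/\ k <= e, k <= r%:num & k <= r%:num - m].
  by rewrite !ge_min !lexx !orbT.
have q0 : 0 < r%:num - k / 2 by lra.
exists (PosNum q0); split=> /=; [lra|lra|apply: eO].
by rewrite /ball/= opprB addrC subrK gtr0_norm; lra.
Qed.

Lemma cone_add_continuous (R : realType) (B : topConvType R)
    (hB : semitopological_barycentric B) (v : cone_of B) :
  continuous (fun u : cone_of B => u + v).
Proof.
have [h1 h2 _] := hB.
apply/continuousP => U /open_coneP oU; apply/open_coneP.
have [Uup oS lU] := oU.
case: v => [[s y]|]; last first.
  by rewrite [X in cone_open X](_ : _ = U)//; apply/seteqP; split=> u /=;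
    rewrite addr0.
split=> [u v|r|r x] /=.
- by rewrite addrAC; exact: Uup.
- by have /continuousP c := h1 (weight r s) y; exact: (c _ (oS _)).
rewrite add_Some => /lU[q /= qrs Uq].
have /continuousP/(_ _ (oS q)) oN := h2 x y.
(* Lower the total weight to q first; then r may decrease as long as r + s
   stays above q, since U is closed under increasing the weight. *)
have [|p [qp pr Np]] := open_weight_lt oN Uq (m := q%:num - s%:num).
  by rewrite ltrBlDr.
exists p => //; apply: (cone_open_ler Uup _ Np) => /=.
by rewrite -lerBlDr ltW.
Qed.

Lemma cone_scale_continuous (R : realType) (B : topConvType R) (a : nnreal R) :
  continuous (fun u : cone_of B => a *: u).
Proof.
have [->|[{}a ->]] := nnreal_posP a.
  rewrite [X in continuous X](_ : _ = cst 0); first exact: cst_continuous.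
  by apply/funext => u; rewrite scale0r.
apply/continuousP => U /open_coneP[Uup oS lU]; apply/open_coneP.
split=> [u v|r|r x] /=.
- by rewrite scalerDr; exact: Uup.
- by under eq_set do rewrite scale_Some.
rewrite scale_Some => /lU[q /= qar Uq].
exists (q%:num / a%:num)%:pos => /=; first by rewrite ltr_pdivrMr// mulrC.
rewrite scale_Some; congr (U (Some (_, _))): Uq; apply/val_inj => /=.
by rewrite mulrC divfK// gt_eqF.
Qed.

Lemma cone_scalel_continuous (R : realType) (B : topConvType R)
    (u : cone_of B) :
  continuous (fun a : nnreal R => a *: u).
Proof.
case: u => [[r x]|]; last first.
  rewrite [X in continuous X](_ : _ = cst 0); first exact: cst_continuous.
  by apply/funext => a; rewrite -[None]/(0 : cone_of B) scaler0.
apply/continuousP => U /open_coneP[Uup oS lU]; apply: open_from_nbhs => a /= Ua.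
have [a0|[b ab]] := nnreal_posP a.
  exists setT; split=> [||b _ /=]; [exact: openT|by []|].
  by move: Ua; rewrite a0 scale0r => /Uup U0; rewrite -[X in U X]add0r.
move: Ua; rewrite ab scale_Some => /lU[q /= qbr Uq].
have qr0 : q%:num / r%:num \in Num.nneg by rewrite nnegrE.
exists [set c : nnreal R | ((q%:num / r%:num)%:E < (c : R)%:E)%E]; split.
- by apply: Or33; exists (NNReal qr0).
- by rewrite /= lte_fin ltr_pdivrMr.
move=> c /=; rewrite lte_fin; have [->|[{}c ->]] := nnreal_posP c.
  by rewrite ltNge /= divr_ge0.
rewrite /= scale_Some ltr_pdivrMr// => qcr.
by apply: (cone_open_ler Uup _ Uq) => /=; rewrite ltW.
Qed.

Lemma cone_semitopological (R : realType) (B : topConvType R)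
    (hB : semitopological_barycentric B) :
  semitopological_cone (cone_of B : topConeType R).
Proof.
split.
- exact: cone_add_continuous.
- move=> u; rewrite [X in continuous X](_ : _ = (fun v : cone_of B => v + u)).
    exact: cone_add_continuous.
  by apply/funext => v; rewrite addrC.
- exact: cone_scale_continuous.
- exact: cone_scalel_continuous.
Qed.

Lemma eta_injective (R : realType) (B : topConvType R) : injective (@eta R B).
Proof. by move=> x y [->]. Qed.

Lemma eta_continuous (R : realType) (B : topConvType R) : continuous (@eta R B).
Proof. by apply/continuousP => U /open_coneP[_ oS _]; exact: oS. Qed.

(** The degenerate coefficients 0 and 1 are separate cases, because 0 *: eta x
is the added zero of the cone and not a pair. *)
Lemma eta_affine (R : realType) (B : topConvType R) :
  affine (@eta R B : B -> cone_of B).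
Proof.
move=> a x y; rewrite /cone_conv.
have [a0|[r rE]] := nnreal_posP (nn01 a).
  have -> : a = 0%:i01 by apply/val_inj; have /(congr1 val) := a0.
  have -> : nn01 (1 - 0%:i01%:num)%:i01 = 1 :> nnreal R.
    by apply/val_inj => /=; rewrite subr0.
  have -> : nn01 0%:i01 = 0 :> nnreal R by apply/val_inj.
  by rewrite conv0 scale0r add0r scale1r.
have [b0|[s sE]] := nnreal_posP (nn01 (1 - a%:num)%:i01).
  have a1 : a = 1%:i01.
    by apply/val_inj; have /(congr1 val)/= /eqP := b0; rewrite subr_eq0 => /eqP.
  have r1 : nn01 a = 1 by rewrite a1; apply/val_inj.
  by rewrite b0 r1 a1 conv1 scale0r addr0 scale1r.
have /= rs : r%:num + s%:num = 1.
  have /(congr1 val)/= <- := rE; have /(congr1 val)/= <- := sE.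
  by rewrite addrC subrK.
rewrite rE sE !scale_Some add_Some; congr (Some (_, _ <| _ |> _));
  apply/val_inj => /=.
  by rewrite !mulr1 rs.
rewrite !mulr1 rs divr1.
exact: (congr1 val rE).
Qed.

(** * Extending maps from the algebra to the cone *)

(** The weights are those of the sum of (r, u) and (s, v) in the cone, which is
why concavity of f becomes superadditivity of its extension. *)
Lemma scale_cone_conv (R : realType) (C : topConeType R) (r s : {posnum R})
    (u v : C) :
  nn_of_pos (r%:num + s%:num)%:pos *: cone_conv (weight r s) u v =
  nn_of_pos r *: u + nn_of_pos s *: v.
Proof.
rewrite /cone_conv scalerDr !scalerA.
by congr (_ *: _ + _ *: _); apply/val_inj => /=; field; rewrite gt_eqF.
Qed.

(** The term (1 - a) *: f y that is dropped is nonnegative for the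
specialization preordering. *)
Lemma concave_semi_concave (R : realType) (B : topConvType R)
    (C : topConeType R) (f : B -> C) :
  semitopological_cone C -> concave f -> semi_concave f.
Proof.
by move=> hC cf a x y; apply: specle_trans (cf a x y); exact: specle_addr.
Qed.

Lemma affine_concave (R : realType) (B : topConvType R) (C : topConeType R)
    (f : B -> C) :
  affine f -> concave f.
Proof. by move=> af a x y; rewrite af => U. Qed.

Definition cone_lift (R : realType) (B : topConvType R) (C : topConeType R)
    (f : B -> C) (u : cone_of B) : C :=
  if u is Some (r, x) then nn_of_pos r *: f x else 0.

Lemma cone_lift_eta (R : realType) (B : topConvType R) (C : topConeType R)
    (f : B -> C) : cone_lift f \o @eta R B = f.
Proof.
apply/funext => x /=; rewrite -[RHS]scale1r; congr (_ *: _); exact/val_inj.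
Qed.

(** Every element of the cone is 0 or r *: eta x. *)
Lemma cone_lift_unique (R : realType) (B : topConvType R) (C : topConeType R)
    (f : B -> C) (g : cone_of B -> C) :
  positively_homogeneous g -> g \o @eta R B = f -> g = cone_lift f.
Proof.
move=> gZ <-; apply/funext => -[[r x]|].
  by rewrite Some_scale gZ /cone_lift -Some_scale.
transitivity (g (0 *: 0)); first by rewrite scale0r.
by rewrite gZ scale0r.
Qed.

Lemma cone_lift_homogeneous (R : realType) (B : topConvType R)
    (C : topConeType R) (f : B -> C) : positively_homogeneous (cone_lift f).
Proof.
move=> a [[r x]|]; have [->|[{}a ->]] := nnreal_posP a.
- by rewrite !scale0r.
- by rewrite scale_Some /cone_lift scalerA; congr (_ *: _); exact/val_inj.
- by rewrite !scale0r.
- by rewrite -[None]/(0 : cone_of B) scaler0 /= scaler0.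
Qed.

(** This is semi-concavity with coefficient r / (r + s), multiplied by r + s. *)
Lemma cone_lift_addr (R : realType) (B : topConvType R) (C : topConeType R)
    (f : B -> C) : semitopological_cone C -> semi_concave f ->
  forall u v : cone_of B, specle (cone_lift f u) (cone_lift f (u + v)).
Proof.
move=> hC scf [[r x]|] [[s y]|]; try exact: (cone_ge0 hC); last by move=> U.
rewrite add_Some /cone_lift.
have -> : nn_of_pos r =
    nn_of_pos (r%:num + s%:num)%:pos * nn01 (weight r s) :> nnreal R.
  by apply/val_inj => /=; field; rewrite gt_eqF.
rewrite -scalerA; apply: specle_homo (scf (weight r s) x y).
by have [_ _ + _] := hC; exact.
Qed.

Lemma cone_lift_continuous (R : realType) (B : topConvType R)
    (C : topConeType R) (f : B -> C) :
  semitopological_cone C -> continuous f -> semi_concave f ->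
  continuous (cone_lift f).
Proof.
move=> hC /continuousP cf scf; apply/continuousP => V oV; apply/open_coneP.
split=> [u v|r|r x] /=.
- exact: cone_lift_addr.
- by have [_ _ /(_ (nn_of_pos r))/continuousP cr _] := hC;
    exact: (cf _ (cr _ oV)).
- exact: open_scale_lt.
Qed.

Lemma cone_lift_superlinear (R : realType) (B : topConvType R)
    (C : topConeType R) (f : B -> C) :
  semitopological_cone C -> concave f -> superlinear (cone_lift f).
Proof.
move=> hC cf; split; first exact: cone_lift_homogeneous.
move=> [[r x]|] [[s y]|]; last 3 first.
- by rewrite [X in specle X _]addr0 => U.
- by rewrite [X in specle X _]add0r => U.
- by rewrite [X in specle X _]add0r => U.
rewrite add_Some /cone_lift -scale_cone_conv; apply: specle_homo (cf _ x y).
by have [_ _ + _] := hC; exact.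
Qed.

Lemma cone_lift_linear (R : realType) (B : topConvType R)
    (C : topConeType R) (f : B -> C) : affine f -> linear_map (cone_lift f).
Proof.
move=> af; split; first exact: cone_lift_homogeneous.
move=> [[r x]|] [[s y]|].
- by rewrite add_Some /cone_lift -scale_cone_conv af.
- by rewrite [RHS]addr0.
- by rewrite [RHS]add0r.
- by rewrite [RHS]add0r.
Qed.

(** Abstracts over the three classes of maps, which share their extension and
the reason for its uniqueness. *)
Lemma cone_lift_exists_unique (R : realType) (B : topConvType R)
    (C : topConeType R) (f : B -> C) (P : (cone_of B -> C) -> Prop) :
  (forall g, P g -> positively_homogeneous g) ->
  P (cone_lift f) -> continuous (cone_lift f) ->
  exists! g : cone_of B -> C, [/\ P g, continuous g & g \o @eta R B = f].
Proof.
move=> PZ Pf cf; exists (cone_lift f); split.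
  by split=> //; exact: cone_lift_eta.
by move=> g [/PZ gZ _ ge]; rewrite (cone_lift_unique gZ ge).
Qed.

(** * The cone of extended nonnegative reals *)

Lemma continuous_ennreal (R : realType) (T : topologicalType)
    (f : T -> ennreal R) :
  (forall a : nnreal R, open [set t | ((a : R)%:E < ennval (f t))%E]) ->
  continuous f.
Proof.
move=> fo; apply/continuousP => _ [->|->|[a ->]].
- by rewrite preimage_set0; exact: open0.
- by rewrite preimage_setT; exact: openT.
- exact: fo.
Qed.

Lemma open_ennreal_gt (R : realType) (a : R) : 0 <= a ->
  open [set u : ennreal R | (a%:E < ennval u)%E].
Proof. by move=> a0; apply: Or33; exists (NNReal (a0 : a \in Num.nneg)). Qed.

Lemma open_nnreal_gt (R : realType) (a : R) : 0 <= a ->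
  open [set u : nnreal R | a < nnval u].
Proof.
move=> a0; apply: Or33; exists (NNReal (a0 : a \in Num.nneg)).
by apply/seteqP; split=> u /=; rewrite lte_fin.
Qed.

Lemma ennreal_add_continuous (R : realType) (v : ennreal R) :
  continuous (fun u : ennreal R => u + v).
Proof.
apply: continuous_ennreal => a /=.
have [va|av] := ltP (a : R)%:E (ennval v).
  rewrite [X in open X](_ : _ = setT); first exact: openT.
  apply/seteqP; split=> // u _ /=; apply: lt_le_trans va _.
  by rewrite leeDr// ennvalP.
have vfin : ennval v \is a fin_num.
  by rewrite ge0_fin_numE ?ennvalP// (le_lt_trans av)// ltry.
move: av; rewrite -(fineK vfin) lee_fin -subr_ge0 => /open_ennreal_gt.
congr open; apply/seteqP; split=> u /=; by rewrite -lteBlDr// -EFinB.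
Qed.

Lemma ennreal_scale_continuous (R : realType) (a : nnreal R) :
  continuous (fun u : ennreal R => a *: u).
Proof.
have [->|[{}a ->]] := nnreal_posP a.
  rewrite [X in continuous X](_ : _ = cst 0); first exact: cst_continuous.
  by apply/funext => u; rewrite scale0r.
apply: continuous_ennreal => b /=.
have : 0 <= a%:num^-1 * (b : R) by rewrite mulr_ge0//; exact: nnvalP b.
move=> /open_ennreal_gt; congr open.
by apply/seteqP; split=> u /=; rewrite EFinM lte_pdivrMl.
Qed.

(** The factors 0 and +oo are separate cases: for u = +oo the preimage of
]b, +oo] is the set of positive scalars, as 0 * +oo = 0. *)
Lemma ennreal_scalel_continuous (R : realType) (u : ennreal R) :
  continuous (fun a : nnreal R => a *: u).
Proof.
apply: continuous_ennreal => b /=; have b0 : 0 <= (b : R) := nnvalP b.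
have [u0|u0] := eqVneq (ennval u) 0%E.
  rewrite [X in open X](_ : _ = set0); first exact: open0.
  by apply/seteqP; split=> // a /=; rewrite u0 mule0 lte_fin ltNge b0.
have {}u0 : (0 < ennval u)%E by rewrite lt_neqAle eq_sym u0 ennvalP.
move: u0; case: (ennval u) => [r||] u0; last by move: u0; rewrite ltNge leNye.
  rewrite lte_fin in u0.
  have : 0 <= (b : R) / r by rewrite divr_ge0// ltW.
  move=> /open_nnreal_gt; congr open.
  by apply/seteqP; split=> a /=; rewrite -EFinM lte_fin ltr_pdivrMr.
have := @open_nnreal_gt R 0 (lexx _); congr open.
apply/seteqP; split=> a /=; first by move=> a0;
  rewrite gt0_muley ?ltry ?lte_fin.
have [->|[{}a -> _]] := nnreal_posP a; last by rewrite /= gt0.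
by rewrite mul0e lte_fin ltNge b0.
Qed.

Lemma ennreal_semitopological (R : realType) :
  semitopological_cone (ennreal R : topConeType R).
Proof.
split.
- exact: ennreal_add_continuous.
- move=> u; rewrite [X in continuous X](_ : _ = (fun v : ennreal R => v + u)).
    exact: ennreal_add_continuous.
  by apply/funext => v; rewrite addrC.
- exact: ennreal_scale_continuous.
- exact: ennreal_scalel_continuous.
Qed.

(** * Minkowski functionals and embeddability *)

(** The supremum of this set is the Minkowski functional of V at u; the element
0 keeps it nonnegative when no positive multiple of u is in V. *)
Definition gauge_set (R : realType) (C : topConeType R) (V : set C) (u : C) :
    set (\bar R) :=
  0%E |` [set (r%:num)%:E | r in
            [set r : {posnum R} | V (nn_of_pos (r%:num^-1)%:pos *: u)]].

Lemma gauge_subproof (R : realType) (C : topConeType R) (V : set C) (u : C) :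
  (0 <= ereal_sup (gauge_set V u))%E.
Proof. by apply: ereal_sup_ubound; left. Qed.

Definition gauge (R : realType) (C : topConeType R) (V : set C) (u : C) :
  ennreal R := ENNReal (gauge_subproof V u).

Lemma gauge_gt (R : realType) (C : topConeType R) (V : set C) (u : C)
    (a : R) : 0 <= a ->
  (a%:E < ennval (gauge V u))%E <->
  exists2 r : {posnum R}, a < r%:num & V (nn_of_pos (r%:num^-1)%:pos *: u).
Proof.
move=> a0; split=> [/ereal_sup_gt[_ [->|[r Vr <-]]]|[r ar Vr]].
- by rewrite lte_fin ltNge a0.
- by rewrite lte_fin => ar; exists r.
apply: (@lt_le_trans _ _ (r%:num)%:E); first by rewrite lte_fin.
by apply: ereal_sup_ubound; right; exists r.
Qed.

(** The set where the functional exceeds a is a union of dilates of V. *)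
Lemma gauge_continuous (R : realType) (C : topConeType R) (V : set C) :
  semitopological_cone C -> open V -> continuous (gauge V).
Proof.
move=> hC oV; apply: continuous_ennreal => a.
rewrite [X in open X](_ : _ =
    \bigcup_(r in [set r : {posnum R} | (a : R) < r%:num])
      (fun u : C => nn_of_pos (r%:num^-1)%:pos *: u) @^-1` V).
  apply: bigcup_open => r _.
  have [_ _ /(_ (nn_of_pos (r%:num^-1)%:pos))/continuousP hZ _] := hC.
  exact: (hZ _ oV).
apply/seteqP; split=> u /=; first by case/(gauge_gt _ _ (nnvalP a))=> r ar Vr;
  exists r.
by case=> r ar Vr; apply/gauge_gt; [exact: nnvalP a|exists r].
Qed.

Lemma specle_scale_ler (R : realType) (C : topConeType R) (r q : {posnum R})
    (u : C) :
  semitopological_cone C -> q%:num <= r%:num ->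
  specle (nn_of_pos q *: u) (nn_of_pos r *: u).
Proof.
move=> hC qr; have rq0 : r%:num - q%:num \in Num.nneg by rewrite nnegrE
  subr_ge0.
have -> : nn_of_pos r = nn_of_pos q + NNReal rq0.
  by apply/val_inj => /=; rewrite addrC subrK.
by rewrite scalerDl; exact: specle_addr.
Qed.

(** Upward closure of V gives one direction, approximation of 1 *: u from below
by scalars less than 1 the other. *)
Lemma gauge_gt1 (R : realType) (C : topConeType R) (V : set C) (u : C) :
  semitopological_cone C -> open V ->
  (1%:E < ennval (gauge V u))%E <-> V u.
Proof.
move=> hC oV; have one : nn_of_pos 1%:pos = 1 :> nnreal R by apply/val_inj.
split=> [/(gauge_gt _ _ ler01)[r r1 Vr]|Vu].
  rewrite -[u]scale1r -one; apply: specle_scale_ler Vr => //=.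
  by rewrite invf_le1// ltW.
have [|q /= q1 Vq] := @open_scale_lt _ _ hC V 1%:pos u oV;
  first by rewrite one scale1r.
apply/gauge_gt; first exact: ler01.
exists (q%:num^-1)%:pos => /=; first by rewrite invf_gt1.
by congr (V (_ *: _)): Vq; apply/val_inj => /=; rewrite invrK.
Qed.

(** If r^-1 f x is in V, then so is (a r)^-1 f (x <| a |> y), which lies above
it because f is semi-concave. *)
Lemma gauge_semi_concave (R : realType) (B : topConvType R) (C : topConeType R)
    (f : B -> C) (V : set C) :
  semitopological_cone C -> semi_concave f -> open V ->
  semi_concave (gauge V \o f).
Proof.
move=> hC scf oV a x y; apply/ennreal_specle => /=.
have [a0|[r rE]] := nnreal_posP (nn01 a).
  by have -> : a%:num = 0 := congr1 val a0; rewrite mul0e;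
    exact: gauge_subproof.
have -> : a%:num = r%:num := congr1 val rE.
rewrite -lee_pdivlMl//; apply: ge_ereal_sup => _ [->|[s Vs <-]].
  by rewrite mule_ge0// ?lee_fin// gauge_subproof.
rewrite lee_pdivlMl// -EFinM; apply: ereal_sup_ubound; right.
exists (r%:num * s%:num)%:pos => //=.
have [_ _ hZ _] := hC.
have := specle_homo (hZ (nn_of_pos ((r%:num * s%:num)%:pos%:num^-1)%:pos))
  (scf a x y).
apply=> //; rewrite rE scalerA; congr (V (_ *: _)): Vs; apply/val_inj => /=.
by field; rewrite !gt_eqF.
Qed.

Theorem theorem3p22 (R : realType) (B : topConvType R)
    (hB : semitopological_barycentric B) :
  [/\ semitopological_cone (cone_of B : topConeType R),
      [/\ injective (@eta R B), affine (@eta R B) & continuous (@eta R B)],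
      (forall (C : topConeType R) (f : B -> C),
        semitopological_cone C -> continuous f ->
        [/\ semi_concave f ->
              exists! g : cone_of B -> C,
                [/\ positively_homogeneous g, continuous g & g \o @eta R B = f],
            concave f ->
              exists! g : cone_of B -> C,
                [/\ superlinear g, continuous g & g \o @eta R B = f] &
            affine f ->
              exists! g : cone_of B -> C,
                [/\ linear_map g, continuous g & g \o @eta R B = f]]) /\
      free_semitopological_cone (@eta R B) &
      [<-> embeddable B;
           topological_embedding (@eta R B);
           (forall U : set B, open U <->
              exists h : B -> ennreal R,
                [/\ semi_concave h, continuous h &
                    U = h @^-1` [set t | (1%:E < ennval t)%E]]);
           is_subbase [set U : set B |
              exists h : B -> ennreal R,
                [/\ semi_concave h, continuous h &
                    U = h @^-1` [set t | (1%:E < ennval t)%E]]]]].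
Proof.
have hK := cone_semitopological hB.
have eta_aff := @eta_affine R B; have eta_cont := @eta_continuous R B.
have eta_sc : semi_concave (@eta R B).
  by apply: concave_semi_concave hK _; exact: affine_concave.
have gt1_open : open [set t : ennreal R | (1%:E < ennval t)%E].
  exact: open_ennreal_gt ler01.
have lifts (C : topConeType R) (f : B -> C) :
    semitopological_cone C -> continuous f ->
    [/\ semi_concave f -> exists! g : cone_of B -> C,
          [/\ positively_homogeneous g, continuous g & g \o @eta R B = f],
        concave f -> exists! g : cone_of B -> C,
          [/\ superlinear g, continuous g & g \o @eta R B = f] &
        affine f -> exists! g : cone_of B -> C,
          [/\ linear_map g, continuous g & g \o @eta R B = f]].
  move=> hC cf; split=> hf; apply: cone_lift_exists_unique => //.
  - exact: cone_lift_homogeneous.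
  - exact: cone_lift_continuous.
  - by move=> g [].
  - exact: cone_lift_superlinear.
  - by apply: cone_lift_continuous => //; exact: concave_semi_concave.
  - by move=> g [].
  - exact: cone_lift_linear.
  - apply: cone_lift_continuous => //; apply: concave_semi_concave => //.
    exact: affine_concave.
split=> //; first by split=> //; exact: eta_injective.
  by split=> //; split=> // C f hC af cf; have [_ _] := lifts C f hC cf; exact.
tfae.
- case=> C [f [hC af /topological_embeddingP[_ cf fo]]].
  apply/topological_embeddingP; split=> //; first exact: eta_injective.
  move=> U /fo[V oV ->]; exists (cone_lift f @^-1` V).
    apply: open_comp oV => u _; apply: cone_lift_continuous => //.
    by apply: concave_semi_concave => //; exact: affine_concave.
  by rewrite -[in LHS](cone_lift_eta f).
- case/topological_embeddingP=> _ _ eo U; split=> [/eo[V oV ->]|[h [_ ch ->]]].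
    (* When V is the whole cone its functional is constantly +oo, and U = B. *)
    exists (gauge V \o @eta R B); split.
    + exact: gauge_semi_concave.
    + by move=> x; apply: continuous_comp;
        [exact: eta_cont|exact: gauge_continuous].
    + by apply/seteqP; split=> x /=; rewrite gauge_gt1.
  by apply: open_comp gt1_open => x _; exact: ch.
- move=> opensE U; split=> [/opensE Uh|[D DF <-]].
    exists [set U]; last by rewrite bigcup_set1.
    by move=> _ ->; exact: (@finI_from1 _ _ _ id).
  apply: bigcup_open => _ /DF[E EF <-]; rewrite bigcap_fset big_seq.
  elim/big_ind: _ => [||A /EF /[!inE] /opensE//]; first exact: openT.
  exact: openI.
- move=> sB; exists (cone_of B), (@eta R B); split=> //.
  apply/topological_embeddingP; split=> //; first exact: eta_injective.
  apply: subbase_preimage sB _ => _ [h [sch ch ->]].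
  exists (cone_lift h @^-1` [set t | (1%:E < ennval t)%E]).
    apply: open_comp gt1_open => u _; apply: cone_lift_continuous => //.
    exact: ennreal_semitopological.
  by rewrite -[in LHS](cone_lift_eta h).
Qed.
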